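(* Let $X,Y$ be real Banach spaces. Suppose $Z$ is a closed subspace of $Y$ such that $Z$ is an $L^1$-predual space and an $M$-ideal in $Y$. Let $T\in\mathcal{K}(X,Y)$ be a multi-smooth operator of finite order. Suppose that $T\perp_B\mathcal{L}(X,Z)$. Then the following hold. (i) $d(T,\mathcal{L}(X,Z))=\sup_{x\in S_X}d(Tx,Z)$. (ii) $T^{**}x_0^{**}\perp_B Z^{\perp\perp}$ for some $x_0^{**}\in M_{T^{**}}$. (iii) $T^{**}\perp_B\mathcal{L}(X^{**},Z^{\perp\perp})$. (iv) There exists $x_0^{**}\in M_{T^{**}}$ such that $$d(T^{**},\mathcal{L}(X^{**},Z^{\perp\perp}))=\sup_{x^{**}\in S_{X^{**}}}d(T^{**}x^{**},Z^{\perp\perp})=d(T^{**}x_0^{**},Z^{\perp\perp})=d(T,\mathcal{L}(X,Z)).$$ Additionally, if $X^*$ is smooth, then in (ii) and (iv) we may choose $x_0^{**}$ from $M_{T^{**}}\cap E_{X^{**}}$.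
   Context: All Banach spaces are real. $\mathcal{L}(X,Y)$ (respectively $\mathcal{K}(X,Y)$) is the space of bounded (respectively compact) linear operators with the operator norm; for a subspace $Z\subset Y$, $\mathcal{L}(X,Z)$ is regarded as a subspace of $\mathcal{L}(X,Y)$. $S_X$, $B_X$ are the unit sphere and closed unit ball of $X$; $E_X$ is the set of extreme points of $B_X$. For an operator $T$ on $X$, $M_T=\{x\in S_X:\|Tx\|=\|T\|\}$. For a subspace $W$ of a normed space $V$ and $v\in V$, $d(v,W)=\inf_{w\in W}\|v-w\|$. Birkhoff-James orthogonality: $v\perp_B w$ means $\|v+\lambda w\|\ge\|v\|$ for all scalars $\lambda$; $v\perp_B W$ means $v\perp_B w$ for all $w\in W$. $Z^\perp=\{y^*\in Y^*:y^*(z)=0\ \forall z\in Z\}$ and $Z^{\perp\perp}\subset Y^{**}$ is the annihilator of $Z^\perp$; $T^{**}:X^{**}\to Y^{**}$ is the second adjoint, and $\mathcal{L}(X^{**},Z^{\perp\perp})$ is regarded as a subspace of $\mathcal{L}(X^{**},Y^{**})$. A Banach space $V$ is smooth if for every non-zero $v\in V$ the set $J(v)=\{v^*\in S_{V^*}:v^*(v)=\|v\|\}$ is a singleton. A non-zero $T\in\mathcal{L}(X,Y)$ is a multi-smooth operator of finite order if the linear span of $J(T)=\{f\in S_{\mathcal{L}(X,Y)^*}:f(T)=\|T\|\}$ is finite-dimensional. A Banach space $V$ is an $L^1$-predual space if $V^*$ is isometrically isomorphic to $L^1(\mu)$ for some positive measure $\mu$. A closed subspace $Z$ of $Y$ is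 an $M$-ideal in $Y$ if there is a linear projection $P:Y^*\to Y^*$ with $\ker P=Z^\perp$ and $\|y^*\|=\|Py^*\|+\|y^*-Py^*\|$ for all $y^*\in Y^*$. *)

(* Defs.v *)
From HB Require Import structures.
From mathcomp Require Import all_boot all_order all_algebra.
From mathcomp Require Import all_classical all_reals all_analysis.

Set Implicit Arguments.
Unset Strict Implicit.
Unset Printing Implicit Defensive.

Import Order.TTheory GRing.Theory Num.Theory.
Import numFieldNormedType.Exports.

Local Open Scope classical_set_scope.
Local Open Scope ring_scope.

Section BoundedOperators.
Context (R : realType) (X Y : normedModType R).

Definition bounded_linear : {pred X -> Y} := fun f =>
  `[< linear f /\ exists M : R, forall x, `|f x| <= M * `|x| >].

Lemma bounded_linear_submod : submod_closed bounded_linear.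
Proof.
split.
  apply/asboolP; split; first by move=> a x y /=; rewrite scaler0 addr0.
  by exists 0 => x; rewrite mul0r normr0.
move=> a f g /asboolP[lf [M fM]] /asboolP[lg [N gN]]; apply/asboolP; split.
  move=> b x y; rewrite !fctE /= lf lg !scalerDr !scalerA (mulrC a b).
  by rewrite addrACA.
exists (`|a| * M + N) => x; rewrite !fctE (le_trans (ler_normD _ _))//.
by rewrite mulrDl lerD// normrZ -mulrA ler_wpM2l.
Qed.

HB.instance Definition _ := GRing.isSubmodClosed.Build R (X -> Y)
  bounded_linear bounded_linear_submod.

Record blin := Blin {
  blin_fun :> X -> Y;
  blinP : blin_fun \in bounded_linear }.

HB.instance Definition _ := [isSub for blin_fun].
HB.instance Definition _ := [Choice of blin by <:].
HB.instance Definition _ := [SubChoice_isSubLmodule of blin by <:].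

Lemma blin_linear (T : blin) : linear T.
Proof. by have /asboolP[] := blinP T. Qed.

HB.instance Definition _ (T : blin) :=
  GRing.isLinear.Build R X Y *:%R T (blin_linear T).

Definition opnorm (T : blin) : R := sup [set `|T x| | x in [set x | `|x| <= 1]].

Lemma opnorm_has_sup (T : blin) :
  has_sup [set `|T x| | x in [set x | `|x| <= 1]].
Proof.
split; first by exists `|T 0|, 0 => //=; rewrite normr0.
have /asboolP[_ [M TM]] := blinP T; exists `|M| => _ [x /= x1 <-].
rewrite (le_trans (TM x))// (le_trans (ler_norm _))// normrM normr_id.
by rewrite ler_piMr.
Qed.

Lemma opnorm_ge (T : blin) x : `|x| <= 1 -> `|T x| <= opnorm T.
Proof. by move=> x1; apply: (sup_upper_bound (opnorm_has_sup T)); exists x. Qed.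

Lemma opnorm_le (T : blin) c :
  (forall x, `|x| <= 1 -> `|T x| <= c) -> opnorm T <= c.
Proof.
move=> Tc; apply: ge_sup; first by case: (opnorm_has_sup T).
by move=> _ [x /= x1 <-]; exact: Tc.
Qed.

Lemma opnormD (S T : blin) : opnorm (S + T) <= opnorm S + opnorm T.
Proof.
apply: opnorm_le => x x1.
by rewrite (le_trans (ler_normD _ _))// lerD// opnorm_ge.
Qed.

Lemma opnormZ_le a (T : blin) : opnorm (a *: T) <= `|a| * opnorm T.
Proof.
by apply: opnorm_le => x x1; rewrite normrZ ler_wpM2l// opnorm_ge.
Qed.

Lemma opnormZ a (T : blin) : opnorm (a *: T) = `|a| * opnorm T.
Proof.
apply/eqP; rewrite eq_le opnormZ_le /=.
have [->|a0] := eqVneq a 0.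
  rewrite normr0 mul0r.
  by rewrite (le_trans (normr_ge0 _) (opnorm_ge _ (x := 0) _))// normr0.
have := opnormZ_le a^-1 (a *: T).
by rewrite scalerA mulVf// scale1r normfV ler_pdivlMl ?normr_gt0.
Qed.

Lemma opnorm_eq0 (T : blin) : opnorm T = 0 -> T = 0.
Proof.
move=> T0; apply/val_inj/funext => x /=.
have [->|x0] := eqVneq x 0; first exact: (linear0 T).
have := opnorm_ge T (x := `|x|^-1 *: x).
rewrite normfZV// T0 linearZ /= normrZ => /(_ (lexx _)) h.
apply/eqP; rewrite -normr_le0; move: h; rewrite pmulr_rle0//.
by rewrite normr_gt0 invr_eq0 normr_eq0.
Qed.

HB.instance Definition _ :=
  Lmodule_isNormed.Build R blin opnormD opnormZ opnorm_eq0.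

End BoundedOperators.

Definition dual (R : realType) (X : normedModType R) := blin X R^o.

HB.instance Definition _ (R : realType) (X : normedModType R) :=
  NormedModule.on (dual X).

Section Adjoint.
Context (R : realType) (X Y : normedModType R).

Lemma adjoint_fun_subproof (T : blin X Y) (f : dual Y) :
  (f \o T : X -> R^o) \in @bounded_linear R X R^o.
Proof.
apply/asboolP; split; first by move=> a x y /=; rewrite !linearP.
have /asboolP[_ [M TM]] := blinP T; have /asboolP[_ [N fN]] := blinP f.
exists (`|N| * M) => x /=; rewrite (le_trans (fN _))//.
rewrite (@le_trans _ _ (`|N| * `|T x|))//.
  by rewrite ler_wpM2r// ler_norm.
by rewrite -mulrA ler_wpM2l.
Qed.

Definition adjoint_fun (T : blin X Y) (f : dual Y) : dual X :=
  Blin (adjoint_fun_subproof T f).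

Lemma adjoint_subproof (T : blin X Y) :
  adjoint_fun T \in @bounded_linear R (dual Y) (dual X).
Proof.
apply/asboolP; split; first by move=> a f g; apply/val_inj/funext.
exists `|T| => f.
have fle y : `|f y| <= `|f| * `|y|.
  have [->|y0] := eqVneq y 0; first by rewrite (linear0 f) !normr0 mulr0.
  have := opnorm_ge f (x := `|y|^-1 *: y).
  rewrite normfZV// linearZ /= normrZ normfV normr_id => /(_ (lexx _)).
  by rewrite ler_pdivrMl ?normr_gt0// mulrC.
apply: opnorm_le => x x1 /=; rewrite (le_trans (fle _))// mulrC.
by rewrite ler_wpM2r// opnorm_ge.
Qed.

Definition adjoint (T : blin X Y) : blin (dual Y) (dual X) :=
  Blin (adjoint_subproof T).

End Adjoint.

Section Subspaces.
Context (R : realType) (V : normedModType R).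

Definition subspace_of (Z : submodClosed V) := {x : V | x \in Z}.

Section Normed.
Context (Z : submodClosed V).
HB.instance Definition _ := SubChoice.on (subspace_of Z).
HB.instance Definition _ := [SubChoice_isSubLmodule of subspace_of Z by <:].

Let subnorm (x : subspace_of Z) : R := `|val x|.
Let subnormD x y : subnorm (x + y) <= subnorm x + subnorm y.
Proof. exact: ler_normD. Qed.
Let subnormZ a x : subnorm (a *: x) = `|a| * subnorm x.
Proof. exact: normrZ. Qed.
Let subnorm_eq0 x : subnorm x = 0 -> x = 0.
Proof. by move=> /normr0_eq0 x0; exact: val_inj. Qed.

HB.instance Definition _ := Lmodule_isNormed.Build R (subspace_of Z)
  subnormD subnormZ subnorm_eq0.
End Normed.

Definition annihilator (Z : {pred V}) : {pred dual V} := fun f =>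
  `[< forall z, z \in Z -> f z = 0 >].

Lemma annihilator_submod (Z : {pred V}) : submod_closed (annihilator Z).
Proof.
split; first by apply/asboolP.
move=> a f g /asboolP f0 /asboolP g0; apply/asboolP => z zZ.
by rewrite /= !fctE f0// g0// scaler0 addr0.
Qed.

HB.instance Definition _ (Z : {pred V}) := GRing.isSubmodClosed.Build R (dual V)
  (annihilator Z) (annihilator_submod Z).

Definition operators_into (X : normedModType R) (Z : {pred V}) :
    set (blin X V) := [set T | forall x, T x \in Z].

End Subspaces.
Arguments operators_into {R V} X Z.

Section Geometry.
Context (R : realType) (V : normedModType R).

Definition unit_ball : set V := [set x | `|x| <= 1].

Definition unit_sphere : set V := [set x | `|x| = 1].

Definition extreme_points (A : set V) : set V := [set x | A x /\
  forall y z (t : R), A y -> A z -> 0 < t < 1 ->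
    x = t *: y + (1 - t) *: z -> y = x /\ z = x].

Definition dist_to (W : set V) (v : V) : R := inf [set `|v - w| | w in W].

Definition bj_orthogonal (v w : V) : Prop :=
  forall l : R, `|v| <= `|v + l *: w|.

Definition bj_orthogonal_to (v : V) (W : set V) : Prop :=
  forall w, W w -> bj_orthogonal v w.

Definition support_functionals (v : V) : set (dual V) :=
  [set f : dual V | `|f| = 1 /\ f v = `|v|].

Definition smooth_space : Prop :=
  forall v : V, v != 0 -> exists f, support_functionals v = [set f].

Definition lin_span (A : set V) : set V :=
  [set v | exists n (a : 'I_n -> R) (x : 'I_n -> V),
    (forall i, A (x i)) /\ v = \sum_(i < n) a i *: x i].

Definition finite_dimensional (W : set V) : Prop :=
  exists n (e : 'I_n -> V), W = lin_span (range e).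

Definition M_ideal (Z : submodClosed V) : Prop :=
  closed [set` Z] /\
  exists P : {linear dual V -> dual V},
    [/\ forall f, P (P f) = P f,
        forall f, (P f == 0) = (f \in annihilator Z) &
        forall f, `|f| = `|P f| + `|f - P f| ].

(* LspaceType mu (lexx 1) is the type of a.e.-classes of integrable functions;
   its vector operations are the a.e. pointwise ones, so that linearity of an
   isomorphism onto it is an a.e. identity between representatives. *)
Definition L1_predual : Prop :=
  exists (d : measure_display) (T : measurableType d)
         (mu : {measure set T -> \bar R})
         (Phi : dual V -> LspaceType mu (lexx (1 : \bar R)%E)),
    [/\ bijective Phi,
        forall (a : R) (f g : dual V),
          {ae mu, forall t, Phi (a *: f + g) t = a * Phi f t + Phi g t} &
        forall f, ('N[mu]_1[EFin \o Phi f] = `|f|%:E)%E ].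

End Geometry.
Arguments unit_ball {R} V.
Arguments unit_sphere {R} V.
Arguments smooth_space {R} V.
Arguments L1_predual {R} V.

Section OperatorNotions.
Context (R : realType) (X Y : normedModType R).

Definition compact_operator (T : blin X Y) : Prop :=
  precompact (T @` unit_ball X).

Definition norm_attaining_set (T : blin X Y) : set X :=
  [set x | unit_sphere X x /\ `|T x| = `|T|].

Definition multi_smooth_finite_order (T : blin X Y) : Prop :=
  T != 0 /\ finite_dimensional (lin_span (support_functionals T)).

End OperatorNotions.

(* Main.v *)
Require Import Defs.
From HB Require Import structures.
From mathcomp Require Import all_boot all_order all_algebra.
From mathcomp Require Import all_classical all_reals all_analysis.
From mathcomp Require Import lra.

Set Implicit Arguments.
Unset Strict Implicit.
Unset Printing Implicit Defensive.

Import Order.TTheory GRing.Theory Num.Theory.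
Import numFieldNormedType.Exports.

Local Open Scope classical_set_scope.
Local Open Scope ring_scope.
(** Call [(x, f)] a norming pair when [x] and [f] lie in the unit balls of
    [X**] and [Y*] and [x (T* f)] reaches [c = `|T|]. Everything follows from one
    norming pair whose [f] annihilates [Z]: seen in [Y***], that [f] vanishes on
    the biannihilator of [Z] and takes the value [c] at [T** x], so each distance
    in question, bounded above by [c], is at least [c], and the ones in the
    bidual are attained at [x]. If [X*] is smooth, the face of the unit ball of
    [X**] on which [T* f] attains its norm is a single point, so [x] is extreme
    ([norming_pair_extreme]).

    Suppose no such pair exists. The projection [P] of the M-ideal splits [f]
    into [P f] and [f - P f] with additive norms, and the second summand
    annihilates [Z]; if it were nonzero, normalizing it would give the pair
    excluded. So [P f = f] for every norming pair ([norming_pair_M_ideal]).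

    The functionals [S |-> x (S* f)] of norming pairs support [T], so by
    multi-smoothness finitely many of them, say [phi_i] coming from [(x_i, f_i)],
    span all of them. The linear system [phi_i S = - c] in an unknown finite rank
    operator [S] into [Z] is subject to the Fredholm alternative
    ([fredholm_alternative]).

    If it has a solution [S], then [x (S* f) = - c < 0] for all norming pairs.
    But orthogonality of [T] to [S] makes [`|T + S / n| >= c], and a limit of
    pairs nearly norming [T + S / n] is a norming pair of [T], as [T] is compact,
    with [x (S* f) >= 0] ([bj_norming_pair]): a contradiction.

    If it has none, some combination [\sum_i a_i phi_i] with [\sum_i a_i != 0]
    vanishes on all rank one operators into [Z]. Then for every [g] in [X*] the
    functional [\sum_i a_i x_i(g) f_i] annihilates [Z] while being fixed by [P],
    hence is zero. So the tensor [\sum_i a_i x_i (x) f_i] is zero, and so is its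
    value at [T] ([contraction_eq0]); but that value is [c \sum_i a_i]. *)

(** * Norming functionals *)

Section NormingFunctionals.
Context (R : realType).

Definition sublinear (V : lmodType R) (q : V -> R) : Prop :=
  (forall x y, q (x + y) <= q x + q y) /\
  (forall t x, 0 <= t -> q (t *: x) <= t * q x).

Section Sublinear.
Context (V : lmodType R) (q : V -> R) (q_sub : sublinear q).

Lemma sublinear0 : q 0 = 0.
Proof.
have [qD qZ] := q_sub; apply/le_anti/andP; split.
  by have := qZ 0 0 (lexx _); rewrite scaler0 mul0r.
by have := qD 0 0; rewrite addr0 -{1}[q 0]addr0 lerD2l.
Qed.

Lemma sublinearZ t x : 0 <= t -> q (t *: x) = t * q x.
Proof.
have [qD qZ] := q_sub; rewrite le_eqVlt => /predU1P[<-|t0].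
  by rewrite scale0r mul0r sublinear0.
apply/le_anti/andP; split; first exact: qZ (ltW t0).
have := qZ t^-1 (t *: x); rewrite scalerA mulVf ?gt_eqF// scale1r.
by rewrite ler_pdivlMl// invr_ge0 => /(_ (ltW t0)).
Qed.

Lemma sublinear_geN x : - q (- x) <= q x.
Proof.
have [qD qZ] := q_sub.
by have := qD x (- x); rewrite subrr sublinear0 -lerBlDr sub0r.
Qed.

(** The largest sublinear minorant [p] of [q] with [p (- v) <= - q v]. A minimal
    [q] equals all its slides, which makes it additive. *)
Definition slide (v x : V) : R :=
  inf [set q (x + t *: v) - t * q v | t in [set t | 0 <= t]].

Lemma slide_nonempty v x :
  [set q (x + t *: v) - t * q v | t in [set t | 0 <= t]] !=set0.
Proof. by exists (q (x + 0 *: v) - 0 * q v), 0 => /=. Qed.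

Lemma slide_le v x t : 0 <= t -> slide v x <= q (x + t *: v) - t * q v.
Proof.
move=> t0; apply: ge_inf; last by exists t.
exists (- q (- x)) => _ [s /= s0 <-].
rewrite -(sublinearZ _ s0) lerBrDl -lerBrDr opprK.
have [qD _] := q_sub.
by apply: le_trans (qD _ _); rewrite addrAC subrr add0r.
Qed.

Lemma slide_ge v x c :
  (forall t, 0 <= t -> c <= q (x + t *: v) - t * q v) -> c <= slide v x.
Proof.
move=> h; apply: lb_le_inf; first exact: slide_nonempty.
by move=> _ [t /= t0 <-]; exact: h.
Qed.

Lemma slide_id v x : slide v x <= q x.
Proof.
by have := slide_le v x (lexx 0); rewrite scale0r addr0 mul0r subr0.
Qed.

Lemma slide_sublinear v : sublinear (slide v).
Proof.
have [qD qZ] := q_sub; split=> [x y|s x].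
  rewrite -lerBlDl; apply: slide_ge => t t0.
  rewrite lerBlDl -lerBlDr; apply: slide_ge => s s0.
  have := slide_le v (x + y) (addr_ge0 s0 t0).
  have := qD (x + s *: v) (y + t *: v).
  by rewrite addrACA -scalerDl; lra.
rewrite le_eqVlt => /predU1P[<-|s0].
  by rewrite scale0r mul0r (le_trans (slide_id _ _))// sublinear0.
rewrite -ler_pdivrMl//; apply: slide_ge => t t0.
rewrite ler_pdivrMl//.
have := slide_le v (s *: x) (mulr_ge0 (ltW s0) t0).
by rewrite -scalerA -scalerDr (sublinearZ _ (ltW s0)) mulrBr mulrA.
Qed.

Lemma slide_opp v : slide v (- v) <= - q v.
Proof.
by have := slide_le v (- v) ler01; rewrite scale1r addNr sublinear0 mul1r sub0r.
Qed.

Lemma minimal_sublinear_linear :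
  (forall p, sublinear p -> (forall x, p x <= q x) -> p = q) ->
  linear (q : V -> R^o).
Proof.
move=> qmin; have [qD qZ] := q_sub.
have slideE v : slide v = q.
  by apply: qmin; [exact: slide_sublinear | exact: slide_id].
have qDE x v : q (x + v) = q x + q v.
  apply/le_anti; rewrite qD/= -lerBrDr.
  by have := slide_le v x ler01; rewrite slideE scale1r mul1r.
have qN x : q (- x) = - q x.
  by apply/eqP; rewrite -addr_eq0 -qDE addNr sublinear0.
move=> a x y; rewrite qDE; congr (_ + _).
have [a0|/ltW a0] := leP 0 a; first exact: sublinearZ.
rewrite -[a]opprK scaleNr qN sublinearZ ?oppr_ge0//.
by rewrite scaleNr.
Qed.

End Sublinear.

(** The infimum of a chain of sublinear functions is sublinear, so Zorn's lemma
    yields a minimal sublinear function below [p], and minimality forces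
    linearity. *)
Lemma sublinear_ge_linear (V : lmodType R) (p : V -> R) :
  sublinear p -> exists f : V -> R^o, linear f /\ forall x, f x <= p x.
Proof.
move=> p_sub.
pose T := {q : V -> R | sublinear q /\ forall x, q x <= p x}.
pose below (s t : T) := `[< forall x, sval t x <= sval s x >].
have [| | | |[q [q_sub qp]] qmin] := @Zorn T below.
- by move=> s; apply/asboolP.
- move=> r s t /asboolP rs /asboolP st; apply/asboolP => x.
  exact: le_trans (st x) (rs x).
- move=> [s Ps] [t Pt] /asboolP/= st /asboolP/= ts.
  by apply/eq_exist/funext => x; apply/le_anti; rewrite st ts.
- move=> A Atot; have [A0|/set0P[a Aa]] := eqVneq A set0.
    exists (exist _ p (conj p_sub (fun x => lexx _))) => s.
    by rewrite A0.
  pose m x := inf [set sval s x | s in A].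
  have m_le s x : A s -> m x <= sval s x.
    move=> As; apply: ge_inf; last by exists s.
    exists (- p (- x)) => _ [[t [tsub tp]] _ <-] /=.
    by rewrite (le_trans _ (sublinear_geN tsub _))// lerN2.
  have m_ge x c : (forall s, A s -> c <= sval s x) -> c <= m x.
    move=> h; apply: lb_le_inf; first by exists (sval a x), a.
    by move=> _ [s As <-]; exact: h.
  have m_sub : sublinear m.
    split=> [x y|t x].
      rewrite -lerBlDl; apply: (m_ge) => s As.
      rewrite lerBlDl -lerBlDr; apply: (m_ge) => t At; rewrite lerBlDr.
      have [/asboolP st|/asboolP ts] := Atot _ _ As At.
        apply: le_trans (m_le t _ At) _.
        apply: (le_trans ((svalP t).1.1 _ _)).
        by rewrite lerD.
      apply: le_trans (m_le s _ As) _.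
      apply: (le_trans ((svalP s).1.1 _ _)).
      by rewrite lerD.
    rewrite le_eqVlt => /predU1P[<-|t0].
      rewrite scale0r mul0r (le_trans (m_le a _ Aa))//.
      by rewrite (sublinear0 (svalP a).1).
    rewrite -ler_pdivrMl//; apply: (m_ge) => s As; rewrite ler_pdivrMl//.
    apply: le_trans (m_le s _ As) _.
    by apply: (svalP s).1.2; exact: ltW.
  have mp x : m x <= p x by apply: le_trans (m_le a _ Aa) ((svalP a).2 x).
  exists (exist _ m (conj m_sub mp)) => s As; apply/asboolP => x /=.
  exact: m_le.
exists q; split=> //; apply: minimal_sublinear_linear => // r r_sub rq.
have rp x : r x <= p x := le_trans (rq x) (qp x).
have := qmin (exist _ r (conj r_sub rp)).
by move=> /(_ (asboolT _))/= h; have [] := h rq.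
Qed.

(** The slide of the norm along [v] takes a value at most [- `|v|] at [- v], so
    that every linear minorant of it is norming at [v]. *)
Lemma norming_functional (V : normedModType R) (v : V) :
  exists f : dual V, `|f| <= 1 /\ f v = `|v|.
Proof.
have nsub : sublinear (fun x : V => `|x|).
  split=> [x y|t x t0]; first exact: ler_normD.
  by rewrite normrZ ger0_norm.
have [f [flin fp]] := sublinear_ge_linear (slide_sublinear nsub v).
have fle x : f x <= `|x| := le_trans (fp x) (slide_id nsub v x).
have f0 : f 0 = 0.
  by have := flin (-1) 0 0; rewrite scaler0 addr0 scaleN1r addNr.
have fN x : f (- x) = - f x.
  by have := flin (-1) x 0; rewrite f0 !addr0 !scaleN1r.
have fabs x : `|f x| <= `|x|.
  by rewrite ler_norml fle andbT lerNl -fN -[leRHS]normrN fle.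
have fb : f \in @bounded_linear R V R^o.
  by apply/asboolP; split=> //; exists 1 => x; rewrite mul1r.
exists (Blin fb); split.
  by apply: opnorm_le => x x1; exact: le_trans (fabs x) x1.
apply/le_anti; rewrite /= fle/= -lerN2 -fN.
exact: le_trans (fp _) (slide_opp nsub v).
Qed.

End NormingFunctionals.
(** * Linear algebra *)

Section LinearAlgebra.
Context (F : fieldType).

Lemma spanning_rows n (A : set 'rV[F]_n) :
  exists m (B : 'M[F]_(m, n)),
    (forall i, A (row i B)) /\ forall v, A v -> (v <= B)%MS.
Proof.
pose P m := `[< exists B : 'M[F]_(m, n), row_free B /\ forall i, A (row i B) >].
have P0 : exists m, P m.
  by exists 0; apply/asboolP; exists 0; split=> [|[]//]; rewrite /row_free mxrank0.
have Pn m : P m -> (m <= n)%N.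
  by move=> /asboolP[B [/eqP/esym mB _]]; rewrite mB rank_leq_col.
case: (ex_maxnP P0 Pn) => m /asboolP[B [Bfree BA]] mmax.
exists m, B; split=> // v Av; apply: contraPT isT => vB.
have : P (m + 1)%N; last by move=> /mmax; rewrite addn1 ltnn.
apply/asboolP; exists (col_mx B v); split.
  rewrite /row_free eqn_leq rank_leq_row -addsmxE/= addn1.
  have : (B < B + v)%MS.
    rewrite ltmxE addsmxSl/=; apply: contra vB.
    by apply: submx_trans; exact: addsmxSr.
  by move=> /rank_ltmx; rewrite (eqP Bfree).
move=> i; case: (split_ordP i) => j ->; first by rewrite rowKu.
by rewrite rowKd (ord1 j) (_ : row 0 v = v)//; apply/rowP => k; rewrite mxE.
Qed.

(** In a rank factorization [M = C *m D], the square of [M] vanishes only if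
    [D *m C] does, and [D *m C] has the trace of [M]. *)
Lemma mxtrace_square_eq0 n (M : 'M[F]_n) : M *m M = 0 -> \tr M = 0.
Proof.
move=> M2; have bb : row_base M *m col_base M = 0.
  apply: (row_full_inj (col_base_full M)); rewrite mulmx0.
  apply: (row_free_inj (row_base_free M)); rewrite mul0mx.
  by rewrite mulmxA mulmx_base -mulmxA mulmx_base.
by rewrite -[M]mulmx_base mxtrace_mulC bb mxtrace0.
Qed.

(** The sum [\sum_i u i (B (y i))] is the trace of the operator
    [w |-> \sum_i u i (B w) *: y i], computed by the matrix of the
    [u i (B (y j))]. The [y i] need not be independent, so that this matrix may
    be nonzero when the operator vanishes, but its square is zero. *)
Lemma contraction_eq0 (V W : lmodType F) m (u : 'I_m -> {linear V -> F^o})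
    (y : 'I_m -> W) (B : {linear W -> V}) :
  (forall v, \sum_i u i v *: y i = 0) -> \sum_i u i (B (y i)) = 0.
Proof.
move=> uy0; pose M : 'M[F]_m := \matrix_(i, j) u i (B (y j)).
rewrite -[RHS](@mxtrace_square_eq0 _ M).
  by rewrite /mxtrace; apply: eq_bigr => i _; rewrite mxE.
apply/matrixP => i j; rewrite !mxE.
have := congr1 (u i \o B) (uy0 (B (y j))); rewrite /= !linear0 !linear_sum /=.
move=> uB0; rewrite -[RHS]uB0; apply: eq_bigr => k _.
by rewrite !mxE !linearZ /= mulrC.
Qed.

End LinearAlgebra.

Lemma fredholm_alternative (R : realType) (V : normedModType R) (A : set V) m
    (g : 'I_m -> {linear V -> R^o}) (b : 'I_m -> R) :
  (exists2 S, lin_span A S & forall i, g i S = b i) \/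
  (exists2 a : 'I_m -> R, \sum_i a i * b i != 0 &
    forall S, A S -> \sum_i a i * g i S = 0).
Proof.
pose vec S := \row_(i < m) g i S.
have [k [B [BA AB]]] := spanning_rows (vec @` A).
pose bv := \row_(i < m) b i.
have [/submxP[D bD]|] := boolP (bv <= B)%MS.
  left; have /choice[S AS] : forall i, exists S, A S /\ vec S = row i B.
    by move=> i; have [S ? <-] := BA i; exists S.
  exists (\sum_(i < k) D 0 i *: S i).
    by exists k, (D 0), S; split=> // i; have [] := AS i.
  move=> j; have /rowP/(_ j) := bD; rewrite !mxE => ->.
  rewrite linear_sum; apply: eq_bigr => i _.
  by rewrite linearZ /=; have [_ /rowP/(_ j)] := AS i; rewrite !mxE => ->.
rewrite submxE => /rV0Pn[j bj]; right.
exists (fun i => cokermx B i j).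
  move: bj; rewrite mxE; under eq_bigr => i _ do rewrite mxE mulrC.
  by [].
move=> S AS; have := AB (vec S); rewrite submxE => /(_ (imageP _ AS)) /eqP.
move=> /rowP/(_ j); rewrite !mxE => S0; rewrite -[RHS]S0.
by apply: eq_bigr => i _; rewrite mulrC [in RHS]mxE.
Qed.

Lemma lin_span_range (R : realType) (V : normedModType R) n (e : 'I_n -> V) v :
  lin_span (range e) v -> exists a : 'rV[R]_n, v = \sum_k a 0 k *: e k.
Proof.
move=> [m [a [x [xe ->]]]].
have /choice[h hx] : forall i, exists k, e k = x i.
  by move=> i; have [k _ <-] := xe i; exists k.
exists (\row_k \sum_(i | h i == k) a i); rewrite (partition_big h predT)//=.
apply: eq_bigr => k _; rewrite mxE scaler_suml.
by apply: eq_bigr => i /eqP <-; rewrite hx.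
Qed.

(** Coordinates on the span of [A] turn [B] into a set of row vectors, so the
    spanning family can be taken from [B] itself. *)
Lemma finite_dimensional_spanning (R : realType) (V : normedModType R)
    (A B : set V) :
  B `<=` A -> finite_dimensional (lin_span A) ->
  exists m (v : 'I_m -> V), (forall i, B (v i)) /\
    forall w, B w -> exists D : 'I_m -> R, w = \sum_i D i *: v i.
Proof.
move=> BA [n [e Ae]].
pose comb (a : 'rV[R]_n) := \sum_k a 0 k *: e k.
have combE w : B w -> exists a, w = comb a.
  move=> /BA Aw; apply: lin_span_range; rewrite -Ae.
  exists 1, (fun=> 1), (fun=> w); split=> //.
  by rewrite big_ord1 scale1r.
have [m [M [MB BM]]] := spanning_rows (B \o comb).
exists m, (fun i => comb (row i M)); split=> // w Bw.
have [a wa] := combE _ Bw; have /submxP[D aD] : (a <= M)%MS.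
  by apply: BM; rewrite /= -wa.
exists (D 0); rewrite wa aD /comb.
under eq_bigr => k _ do rewrite mxE scaler_suml.
rewrite exchange_big; apply: eq_bigr => i _; rewrite scaler_sumr.
by apply: eq_bigr => k _; rewrite mxE scalerA.
Qed.

(** * Bounded operators and weak limits along ultrafilters *)

Section BoundedOperatorLemmas.
Context (R : realType).

Lemma blin_norm_le (X Y : normedModType R) (T : blin X Y) x :
  `|T x| <= `|T| * `|x|.
Proof.
have [->|x0] := eqVneq x 0; first by rewrite linear0 !normr0 mulr0.
have := opnorm_ge T (x := `|x|^-1 *: x).
rewrite normfZV// linearZ /= normrZ normfV normr_id => /(_ (lexx _)).
by rewrite ler_pdivrMl ?normr_gt0// mulrC.
Qed.

Lemma dual_le (X : normedModType R) (f : dual X) x :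
  `|f| <= 1 -> f x <= `|x|.
Proof.
move=> f1; apply: le_trans (ler_norm _) _; apply: le_trans (blin_norm_le f x) _.
by rewrite ler_piMl.
Qed.

Lemma adjoint_norm_le (X Y : normedModType R) (T : blin X Y) :
  `|adjoint T| <= `|T|.
Proof.
apply: opnorm_le => f f1; apply: opnorm_le => x x1 /=.
apply: le_trans (blin_norm_le f _) _; apply: le_trans (opnorm_ge T x1).
by rewrite ler_piMl.
Qed.

Lemma blin_of_linear (X Y : normedModType R) (f : X -> Y) (M : R) :
  linear f -> (forall x, `|f x| <= M * `|x|) ->
  exists F : blin X Y, forall x, F x = f x.
Proof.
move=> flin fM.
have fb : f \in @bounded_linear R X Y by apply/asboolP; split=> //; exists M.
by exists (Blin fb).
Qed.

Lemma evaluation_subproof (X : normedModType R) (x : X) :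
  (fun f : dual X => f x : R^o) \in @bounded_linear R (dual X) R^o.
Proof.
apply/asboolP; split; first by [].
by exists `|x| => f; rewrite mulrC blin_norm_le.
Qed.

Definition evaluation (X : normedModType R) (x : X) : dual (dual X) :=
  Blin (evaluation_subproof x).

Lemma evaluation_norm_le (X : normedModType R) (x : X) : `|evaluation x| <= `|x|.
Proof.
apply: opnorm_le => f f1; apply: le_trans (blin_norm_le f _) _.
by rewrite ler_piMl.
Qed.

Lemma rank_one_subproof (X Y : normedModType R) (f : dual X) (y : Y) :
  (fun x : X => (f x : R) *: y) \in @bounded_linear R X Y.
Proof.
apply/asboolP; split; first by move=> a u v; rewrite linearP scalerDl -scalerA.
exists (`|f| * `|y|) => x; rewrite normrZ mulrAC ler_wpM2r//.
exact: blin_norm_le.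
Qed.

Definition rank_one (X Y : normedModType R) (f : dual X) (y : Y) : blin X Y :=
  Blin (rank_one_subproof f y).

(** For bounded sequences, an ultrafilter limit stands in for the weak-star
    cluster points that the Banach-Alaoglu theorem provides. *)
Section Ultralimits.
Context (U : set_system nat) {UU : UltraFilter U}.

Lemma ultra_cvg_compact (S : topologicalType) (K : set S) (u : nat -> S) :
  compact K -> (forall n, K (u n)) -> exists p : S, u n @[n --> U] --> p.
Proof.
move=> Kco Ku; have UK : (u n @[n --> U]) K by apply: (@filterE _ U) => n; exact: Ku.
have [p [_ up]] := Kco _ _ UK.
exists p => N Np; have [//|UN] := in_ultra_setVsetC (u @^-1` N) UU.
have [q [/= Nq]] := up (~` N) N UN Np.
by [].
Qed.

Lemma ultra_cvg_bounded (u : nat -> R^o) (M : R) :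
  (forall n, `|u n| <= M) -> exists p : R^o, u n @[n --> U] --> p.
Proof.
move=> uM; apply: (ultra_cvg_compact (@segment_compact R (- M) M)) => n.
by rewrite /= in_itv/= -ler_norml.
Qed.

Lemma ultra_limit_unique (u : nat -> R^o) (p q : R^o) :
  u n @[n --> U] --> p -> u n @[n --> U] --> q -> p = q.
Proof. exact: norm_cvg_unique. Qed.

Lemma ultralimit_functional (V : normedModType R) (f : nat -> dual V) :
  (forall n, `|f n| <= 1) ->
  exists g : dual V, `|g| <= 1 /\ forall v, f n v @[n --> U] --> g v.
Proof.
move=> f1.
have fle n v : `|f n v| <= `|v|.
  by apply: le_trans (blin_norm_le (f n) v) _; rewrite ler_piMl.
have /choice[g fg] : forall v, exists p : R^o, f n v @[n --> U] --> p.
  by move=> v; exact: ultra_cvg_bounded (fun n => fle n v).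
have gle v : `|g v| <= 1 * `|v|.
  rewrite mul1r; apply: (@cvgr_to_le nat U _ R (fun n => `|f n v|)).
    by have := cvg_norm (fg v); exact.
  by apply: filterE => n; exact: fle.
have glin : linear g.
  move=> a v w; apply: ultra_limit_unique (fg (a *: v + w)) _.
  rewrite (_ : (fun n => _) = (fun n => a *: (f n v : R^o) + f n w)).
    apply: (@cvgD _ R^o _ _ _ _ _ (a *: g v) (g w)); last exact: fg.
    exact: (@cvgZl_tmp _ R^o _ _ _ a _ _ (fg v)).
  by apply/funext => n; rewrite linearP.
have [G Gg] := blin_of_linear glin gle; exists G; split.
  by apply: opnorm_le => v v1; rewrite Gg (le_trans (gle v))// mul1r.
by move=> v; rewrite Gg.
Qed.

End Ultralimits.

(** Weak-star continuity of [(x, f) |-> x (adjoint S f)] along bounded sequences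
    and in both variables at once; it is what lets norming pairs pass to the
    limit. *)
Definition jointly_continuous (X Y : normedModType R) (S : blin X Y) : Prop :=
  forall (U : set_system nat) (x : nat -> X) (f : nat -> dual Y)
         (x0 : dual (dual X)) (f0 : dual Y),
    UltraFilter U -> (forall n, `|x n| <= 1) -> (forall n, `|f n| <= 1) ->
    (forall g : dual X, g (x n) @[n --> U] --> x0 g) ->
    (forall y, f n y @[n --> U] --> f0 y) ->
    f n (S (x n)) @[n --> U] --> x0 (adjoint S f0).

(** By compactness [S (x n)] has a limit [w] in norm, and then
    [f n (S (x n))] and [f n w] have the same limit [f0 w]. *)
Lemma compact_jointly_continuous (X Y : normedModType R) (S : blin X Y) :
  compact_operator S -> jointly_continuous S.
Proof.
rewrite /compact_operator precompactE => Sco U x f x0 f0 UU x1 f1 xx0 ff0.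
have [|w Sw] := ultra_cvg_compact (u := fun n => S (x n)) Sco.
  by move=> n; apply: subset_closure; exists (x n) => //; exact: x1.
have f0Sx : f0 (S (x n)) @[n --> U] --> f0 w.
  apply/cvgrPdist_le => e e0.
  have e'0 : 0 < e / (`|f0| + 1) by rewrite divr_gt0// ltr_wpDl.
  move/cvgrPdist_le : Sw => /(_ _ e'0); apply: filterS => n h.
  rewrite -linearB; apply: le_trans (blin_norm_le f0 _) _.
  rewrite ler_pdivlMr ?ltr_wpDl// in h; apply: le_trans h.
  by rewrite mulrC ler_wpM2l// lerDl.
rewrite (_ : x0 _ = f0 w); last first.
  by apply: ultra_limit_unique f0Sx; exact: xx0.
apply/cvgrPdist_le => e e0; have e20 : 0 < e / 2 by rewrite divr_gt0.
move/cvgrPdist_le : Sw => /(_ _ e20) Sw.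
move/cvgrPdist_le : (ff0 w) => /(_ _ e20) fw.
near=> n.
rewrite (_ : f0 w - f n (S (x n)) = (f0 w - f n w) + f n (w - S (x n))).
  rewrite (splitr e); apply: le_trans (ler_normD _ _) _; apply: lerD.
    by near: n.
  apply: le_trans (blin_norm_le (f n) _) _.
  rewrite (@le_trans _ _ `|w - S (x n)|)// ?ler_piMl//.
  by near: n.
by rewrite linearB addrA subrK.
Unshelve. all: by end_near. Qed.

Lemma rank_one_jointly_continuous (X Y : normedModType R) (g : dual X) (y : Y) :
  jointly_continuous (rank_one g y).
Proof.
move=> U x f x0 f0 UU x1 f1 xx0 ff0.
rewrite (_ : adjoint _ _ = (f0 y : R) *: g); last first.
  by apply/val_inj/funext => v; rewrite /= linearZ; exact: mulrC.
rewrite linearZ /=.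
have -> : (fun n => f n (rank_one g y (x n))) = (fun n => f n y * g (x n)).
  by apply/funext => n; rewrite /= linearZ; exact: mulrC.
by have := cvgM (ff0 y) (xx0 g); exact.
Qed.

Lemma lin_span_jointly_continuous (X Y : normedModType R) (A : set (blin X Y)) S :
  (forall T, A T -> jointly_continuous T) -> lin_span A S ->
  jointly_continuous S.
Proof.
move=> Ajc [n [a [T [AT ->]]]].
elim/big_ind : _ => [|S1 S2 h1 h2|i _] U x f x0 f0 UU x1 f1 xx0 ff0.
- rewrite (_ : adjoint _ _ = 0) ?linear0.
    have -> : (fun n => f n ((0 : blin X Y) (x n))) = cst 0.
      by apply/funext => k; rewrite /= linear0.
    exact: cvg_cst.
  by apply/val_inj/funext => v; rewrite /= linear0.
- rewrite (_ : adjoint _ _ = adjoint S1 f0 + adjoint S2 f0) ?linearD.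
    have -> : (fun n => f n ((S1 + S2) (x n))) =
              (fun n => f n (S1 (x n)) + f n (S2 (x n))).
      by apply/funext => k; rewrite /= linearD.
    by apply: cvgD; [exact: h1|exact: h2].
  by apply/val_inj/funext => v; rewrite /= linearD.
- rewrite (_ : adjoint _ _ = a i *: adjoint (T i) f0) ?linearZ /=.
    have -> : (fun n => f n ((a i *: T i) (x n))) =
              (fun n => a i *: (f n (T i (x n)) : R^o)).
      by apply/funext => k; rewrite /= linearZ.
    by apply: cvgZl_tmp; exact: (Ajc _ (AT i)).
  by apply/val_inj/funext => v; rewrite /= linearZ.
Qed.

End BoundedOperatorLemmas.
(** * Norming pairs *)

Section NormingPairs.
Context (R : realType) (X Y : normedModType R).
Implicit Types (S T : blin X Y) (x : dual (dual X)) (f : dual Y).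

Lemma tensor_subproof x f :
  (fun S : blin X Y => x (adjoint S f) : R^o) \in @bounded_linear R (blin X Y) R^o.
Proof.
apply/asboolP; split.
  move=> a S1 S2; rewrite (_ : adjoint _ f = a *: adjoint S1 f + adjoint S2 f).
    by rewrite linearP.
  by apply/val_inj/funext => v; rewrite /= linearP.
exists (`|x| * `|f|) => S; apply: le_trans (blin_norm_le x _) _.
rewrite -mulrA ler_wpM2l// mulrC; apply: le_trans (blin_norm_le (adjoint S) f) _.
by rewrite ler_wpM2r// adjoint_norm_le.
Qed.

Definition tensor x f : dual (blin X Y) := Blin (tensor_subproof x f).

Lemma tensor_norm_le x f : `|x| <= 1 -> `|f| <= 1 -> `|tensor x f| <= 1.
Proof.
move=> x1 f1; apply: opnorm_le => S S1 /=.
apply: le_trans (blin_norm_le x _) _; apply: mulr_ile1 => //.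
apply: le_trans (blin_norm_le (adjoint S) f) _; apply: mulr_ile1 => //.
exact: le_trans (adjoint_norm_le S) S1.
Qed.

Lemma tensor_le T x f : `|x| <= 1 -> tensor x f T <= `|T| * `|f|.
Proof.
move=> x1; apply: le_trans (dual_le (adjoint T f) x1) _.
apply: le_trans (blin_norm_le (adjoint T) f) _.
by rewrite ler_wpM2r// adjoint_norm_le.
Qed.

Lemma tensorDr T x f g : tensor x (f + g) T = tensor x f T + tensor x g T.
Proof. exact: etrans (congr1 x (linearD (adjoint T) f g)) (linearD x _ _). Qed.

Lemma tensorZr T x a f : tensor x (a *: f) T = a * tensor x f T.
Proof.
have Taf : adjoint T (a *: f) = a *: adjoint T f by exact: linearZ.
exact: etrans (congr1 x Taf) (linearZ_LR _ _ _).
Qed.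

Lemma tensor_rank_one x f (g : dual X) y :
  tensor x f (rank_one g y) = x g * f y.
Proof.
have gy : adjoint (rank_one g y) f = (f y : R) *: g.
  by apply/val_inj/funext => v; rewrite /= linearZ; exact: mulrC.
exact: etrans (congr1 x gy) (etrans (linearZ_LR _ _ _) (mulrC _ _)).
Qed.

Definition norming_pair T x f : Prop :=
  [/\ `|x| <= 1, `|f| <= 1 & `|T| <= tensor x f T].

Lemma norming_pairE T x f : norming_pair T x f -> tensor x f T = `|T|.
Proof.
move=> [x1 f1 Txf]; apply/le_anti; rewrite Txf andbT.
by apply: le_trans (tensor_le T f x1) _; rewrite ler_piMr.
Qed.

Lemma norming_pair_support T x f :
  T != 0 -> norming_pair T x f -> support_functionals T (tensor x f).
Proof.
move=> T0 Txf; have TE := norming_pairE Txf; have [x1 f1 _] := Txf.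
split=> //; apply/le_anti; rewrite tensor_norm_le//=.
have T_gt0 : 0 < `|T| by rewrite normr_gt0.
rewrite -(ler_pM2r T_gt0) mul1r -{1}TE.
exact: le_trans (ler_norm _) (blin_norm_le _ _).
Qed.

(** A one-sided derivative of the norm at [T] in the direction [S]: pairs nearly
    norming [T + e *: S] are nearly norming for [T], and as [T] alone cannot
    exceed its norm, their value at [S] is nearly nonnegative. *)
Lemma bj_norming_pair T S :
  jointly_continuous T -> jointly_continuous S -> bj_orthogonal T S ->
  exists x f, norming_pair T x f /\ 0 <= tensor x f S.
Proof.
move=> Tjc Sjc TS; pose e n : R := harmonic n.
have e0 n : 0 < e n by exact: harmonic_gt0.
(* An error of order [e n ^+ 2] still vanishes after division by [e n]. *)
have /choice[xf xfP] : forall n, exists p : X * dual Y,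
    [/\ `|p.1| <= 1, `|p.2| <= 1 &
        `|T| - e n * e n < p.2 (T p.1) + e n * p.2 (S p.1)].
  move=> n; pose Tn := T + e n *: S.
  have [v [v1 Tv]] : exists v, `|v| <= 1 /\ `|T| - e n * e n < `|Tn v|.
    apply: contrapT => /forallNP noV.
    have : `|Tn| <= `|T| - e n * e n.
      apply: opnorm_le => v v1; rewrite leNgt; apply/negP => Tv.
      by apply: (noV v).
    move=> /(le_trans (TS (e n))); apply/negP.
    by rewrite -ltNge ltrBlDr ltrDl mulr_gt0.
  have [f [f1 fv]] := norming_functional (Tn v).
  have fE : f (Tn v) = f (T v) + e n * f (S v) by rewrite /= linearD linearZ.
  by exists (v, f); rewrite /= -fE fv.
have [U [UU ooU]] := ultraFilterLemma (eventually_filter).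
pose v n := (xf n).1; pose f n := (xf n).2.
have v1 n : `|v n| <= 1 by have [] := xfP n.
have f1 n : `|f n| <= 1 by have [] := xfP n.
have vfP n : `|T| - e n * e n < f n (T (v n)) + e n * f n (S (v n)).
  by have [] := xfP n.
have vf_le S' n : `|f n (S' (v n))| <= `|S'|.
  apply: le_trans (blin_norm_le _ _) _.
  apply: (@le_trans _ _ `|S' (v n)|); first by rewrite ler_piMl.
  exact: opnorm_ge.
have [x0 [x01 vx0]] : exists x0 : dual (dual X), `|x0| <= 1 /\
    forall g : dual X, g (v n) @[n --> U] --> x0 g.
  apply: (ultralimit_functional (f := fun n => evaluation (v n))) => n.
  exact: le_trans (evaluation_norm_le _) (v1 n).
have [f0 [f01 ff0]] := ultralimit_functional f1.
have eU : e n @[n --> U] --> (0 : R).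
  by move=> N N0; apply: ooU; exact: (@cvg_harmonic R _ N0).
have TU : f n (T (v n)) @[n --> U] --> (tensor x0 f0 T : R) by exact: Tjc.
have SU : f n (S (v n)) @[n --> U] --> (tensor x0 f0 S : R) by exact: Sjc.
exists x0, f0; split.
  split=> //; rewrite -[leRHS]addr0 -(mul0r (0 + `|S|)).
  apply: (@cvgr_to_ge _ U _ R (fun n => f n (T (v n)) + e n * (e n + `|S|))).
    apply: (cvgD TU); apply: (cvgM eU); apply: (cvgD eU); exact: cvg_cst.
  apply: filterE => n; have := vfP n.
  have := vf_le S n => /(le_trans (ler_norm _)).
  by rewrite -(ler_pM2l (e0 n)); lra.
rewrite -[leRHS]addr0.
apply: (@cvgr_to_ge _ U _ R (fun n => f n (S (v n)) + e n)).
  exact: cvgD SU eU.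
apply: filterE => n; rewrite -(pmulr_rge0 _ (e0 n)) mulrDr.
have := vfP n; have := vf_le T n => /(le_trans (ler_norm _)).
by lra.
Qed.

(** The norms of [P f] and [f - P f] add up, so [x] reaches [`|T|] on [f] only if
    it does so, in proportion to the norm, on each summand. A nonzero [f - P f]
    would thus, once normalized, form a norming pair with [x]. *)
Lemma norming_pair_M_ideal (Z : submodClosed Y) (P : {linear dual Y -> dual Y}) T :
  (forall f, P (P f) = P f) -> (forall f, (P f == 0) = (f \in annihilator Z)) ->
  (forall f, `|f| = `|P f| + `|f - P f|) ->
  (forall x f, norming_pair T x f -> f \notin annihilator Z) ->
  forall x f, norming_pair T x f -> P f = f.
Proof.
move=> PP kerP normP noZ x f Txf; have [x1 f1 T_le] := Txf.
apply/eqP; rewrite eq_sym -subr_eq0; apply: contraT => w0.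
set w := f - P f in w0.
have w_gt0 : 0 < `|w| by rewrite normr_gt0.
have Zw : `|w|^-1 *: w \in annihilator Z.
  by rewrite -kerP linearZ linearB /= PP subrr scaler0.
suff /noZ : norming_pair T x (`|w|^-1 *: w) by rewrite Zw.
split=> //; first by rewrite normfZV.
have xPf := tensor_le T (P f) x1.
have fE : tensor x f T = tensor x (P f) T + tensor x w T.
  by rewrite -tensorDr addrC subrK.
have Tf : `|T| * `|f| <= `|T| by rewrite ler_piMr.
rewrite tensorZr ler_pdivlMl// mulrC.
by move: xPf Tf T_le; rewrite fE (normP f) mulrDr; lra.
Qed.

(** The dichotomy is between a finite rank direction into [Z] along which the
    norm of [T] strictly decreases, and a linear relation between the supporting
    tensors that would make them cancel at [T]. *)
Lemma norming_pair_annihilator (Z : submodClosed Y) T :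
  M_ideal Z -> compact_operator T -> multi_smooth_finite_order T ->
  bj_orthogonal_to T (operators_into X Z) ->
  exists x f, norming_pair T x f /\ f \in annihilator Z.
Proof.
move=> [_ [P [PP kerP normP]]] Tco [T0 Tfin] Tbj.
apply: contrapT => noZ.
have fixP x f : norming_pair T x f -> P f = f.
  apply: (norming_pair_M_ideal PP kerP normP) => {}x {}f Txf.
  by apply/negP => fZ; apply: noZ; exists x, f.
have T_gt0 : 0 < `|T| by rewrite normr_gt0.
pose Phi := [set phi | exists x f, norming_pair T x f /\ phi = tensor x f].
have [|m [phi [Phi_phi phi_span]]] := finite_dimensional_spanning (B := Phi) _ Tfin.
  by move=> _ [x [f [Txf ->]]]; exact: norming_pair_support.
have /choice[p pP] : forall i, exists p : dual (dual X) * dual Y,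
    norming_pair T p.1 p.2 /\ phi i = tensor p.1 p.2.
  by move=> i; have [x [f ?]] := Phi_phi i; exists (x, f).
pose A := [set S : blin X Y | exists (g : dual X) y, y \in Z /\ S = rank_one g y].
have phiT i : phi i T = `|T|.
  by have [Tp ->] := pP i; exact: norming_pairE.
have [[S AS phiS]|[a a0 aA]] :=
    fredholm_alternative A phi (fun=> - `|T|).
  have TS : bj_orthogonal T S.
    apply: Tbj; have [n [c [S' [AS' ->]]]] := AS.
    move=> v; elim/big_ind : _ => [|S1 S2 h1 h2|i _].
    - exact: rpred0.
    - exact: rpredD.
    - by have [g [y [yZ ->]]] := AS' i; rewrite /= !rpredZ.
  have Sjc : jointly_continuous S.
    apply: lin_span_jointly_continuous AS => _ [g [y [_ ->]]].
    exact: rank_one_jointly_continuous.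
  have [x [f [Txf]]] := bj_norming_pair (compact_jointly_continuous Tco) Sjc TS.
  have [D xfD] := phi_span _ (ex_intro _ x (ex_intro _ f (conj Txf erefl))).
  have := norming_pairE Txf.
  have sumE Q : (\sum_i D i *: phi i) Q = \sum_i D i * phi i Q.
    exact: (linear_sum (evaluation Q)).
  rewrite xfD !sumE; under eq_bigr do rewrite phiT.
  under [X in 0 <= X -> _]eq_bigr do rewrite phiS mulrN.
  by rewrite sumrN => ->; rewrite oppr_ge0 leNgt T_gt0.
pose u i := a i *: (p i).1.
have contr : \sum_i u i (adjoint T (p i).2) = 0.
  apply: (contraction_eq0 (u := u)) => g.
  set w := \sum_i _.
  have Pw : P w = w.
    rewrite linear_sum; apply: eq_bigr => i _; rewrite linearZ /=.
    by rewrite (fixP (p i).1)//; have [] := pP i.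
  apply/eqP; rewrite -Pw kerP; apply/asboolP => z zZ.
  have wz : w z = \sum_i u i g * (p i).2 z := linear_sum (evaluation z) _ _ _.
  rewrite wz -[RHS](aA (rank_one g z)); last by exists g, z.
  apply: eq_bigr => i _; have [_ ->] := pP i.
  by rewrite [X in _ = a i * X]tensor_rank_one mulrA.
have uT i : u i (adjoint T (p i).2) = a i * `|T|.
  by rewrite -(phiT i); have [_ ->] := pP i.
apply/negP: a0; rewrite negbK -mulr_suml mulrN oppr_eq0 mulr_suml.
by under eq_bigr do rewrite -uT; rewrite contr.
Qed.

End NormingPairs.
(** * Distances and orthogonality *)

Section Distance.
Context (R : realType) (V : normedModType R) (W : set V) (W0 : W 0).

Lemma dist_to_ge c v : (forall w, W w -> c <= `|v - w|) -> c <= dist_to W v.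
Proof.
move=> h; apply: lb_le_inf; first by exists `|v - 0|, 0.
by move=> _ [w Ww <-]; exact: h.
Qed.

Lemma dist_to_le_norm v : dist_to W v <= `|v|.
Proof.
rewrite -[in leRHS](subr0 v); apply: ge_inf; last by exists 0.
by exists 0 => _ [w _ <-].
Qed.

Lemma bj_dist_to v : bj_orthogonal_to v W -> dist_to W v = `|v|.
Proof.
move=> vW; apply/le_anti; rewrite dist_to_le_norm dist_to_ge// => w Ww.
by rewrite -scaleN1r; exact: vW.
Qed.

Lemma dist_to_ge_functional (f : dual V) v :
  `|f| <= 1 -> (forall w, W w -> f w = 0) -> f v <= dist_to W v.
Proof.
move=> f1 fW; apply: dist_to_ge => w Ww.
have <- : f (v - w) = f v by rewrite linearB /= (fW w Ww); exact: subr0.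
exact: dual_le.
Qed.

Lemma bj_orthogonal_to_functional (f : dual V) v :
  `|f| <= 1 -> (forall w, W w -> f w = 0) -> `|v| <= f v ->
  bj_orthogonal_to v W.
Proof.
move=> f1 fW fv w Ww l; apply: (le_trans fv).
have <- : f (v + l *: w) = f v.
  by rewrite linearD linearZ /= (fW w Ww) scaler0; exact: addr0.
exact: dual_le.
Qed.

End Distance.

Section Bidual.
Context (R : realType) (X Y : normedModType R) (T : blin X Y).
Context (x : dual (dual X)) (f : dual Y).
Context (T0 : T != 0) (Txf : norming_pair T x f).

Let Tss := adjoint (adjoint T).

Lemma norming_pair_image_ge : `|T| <= `|Tss x|.
Proof.
have [x1 f1 Tle] := Txf; apply: le_trans Tle _.
by apply: le_trans (ler_norm _) _; apply: le_trans (opnorm_ge (Tss x) f1).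
Qed.

Lemma norm_biadjoint : `|Tss| = `|T|.
Proof.
apply/le_anti/andP; split.
  exact: le_trans (adjoint_norm_le (adjoint T)) (adjoint_norm_le T).
have [x1 _ _] := Txf; apply: le_trans norming_pair_image_ge _.
exact: (opnorm_ge Tss x1).
Qed.

Lemma norming_pair_attains : norm_attaining_set Tss x.
Proof.
have [x1 _ _] := Txf; have T_gt0 : 0 < `|T| by rewrite normr_gt0.
have Tssx := blin_norm_le Tss x; rewrite norm_biadjoint in Tssx.
have Tx := norming_pair_image_ge.
split; last first.
  apply/le_anti; rewrite norm_biadjoint Tx andbT.
  by apply: le_trans Tssx _; rewrite ler_piMr.
apply/le_anti; rewrite x1/= -(ler_pM2l T_gt0) mulr1.
exact: le_trans Tx Tssx.
Qed.

Lemma norming_pair_bj (Z : submodClosed Y) : f \in annihilator Z ->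
  bj_orthogonal_to (Tss x) [set` annihilator (annihilator Z)].
Proof.
move=> fZ; have [x1 f1 Tle] := Txf.
apply: (@bj_orthogonal_to_functional _ _ _ (evaluation f)).
- exact: le_trans (evaluation_norm_le f) f1.
- by move=> w /= /asboolP; exact.
- have [_ ->] := norming_pair_attains.
  by rewrite norm_biadjoint.
Qed.

Lemma bj_orthogonal_operators (W : {pred dual (dual Y)}) :
  bj_orthogonal_to (Tss x) [set` W] ->
  bj_orthogonal_to Tss (operators_into (dual (dual X)) W).
Proof.
move=> xW S SW l; have [x1 _ _] := Txf; have [_ <-] := norming_pair_attains.
exact: le_trans (xW (S x) (SW x) l) (opnorm_ge (Tss + l *: S) x1).
Qed.

(** The face of the unit ball on which [adjoint T f] attains its norm is the set
    of its support functionals, by smoothness a single point, hence extreme. *)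
Lemma norming_pair_extreme :
  smooth_space (dual X) -> extreme_points (unit_ball (dual (dual X))) x.
Proof.
move=> Xsmooth; have [x1 f1 Tle] := Txf; split=> // y z t y1 z1 /andP[t0 t1] xyz.
set g := adjoint T f; have T_gt0 : 0 < `|T| by rewrite normr_gt0.
have gle : `|g| <= `|T|.
  apply: le_trans (blin_norm_le (adjoint T) f) _.
  by apply: le_trans (ler_piMr _ f1) (adjoint_norm_le T).
have g_ge (u : dual (dual X)) : `|u| <= 1 -> u g <= `|g| by exact: dual_le.
have xg : x g = `|g|.
  by apply/le_anti; rewrite g_ge//=; apply: le_trans Tle.
have g_gt0 : 0 < `|g| by rewrite -xg; exact: lt_le_trans Tle.
have [s sE] : exists s, support_functionals g = [set s].
  by apply: Xsmooth; rewrite -normr_gt0.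
have uniq (u : dual (dual X)) : `|u| <= 1 -> u g = `|g| -> u = s.
  move=> u1 ug; have : support_functionals g u; last by rewrite sE.
  split=> //; apply/le_anti; rewrite u1/= -(ler_pM2r g_gt0) mul1r -{1}ug.
  exact: le_trans (ler_norm _) (blin_norm_le u g).
have xyzg : x g = t * y g + (1 - t) * z g by rewrite xyz.
have yg := g_ge _ y1; have zg := g_ge _ z1.
have ygE : y g = `|g| by apply/le_anti; rewrite yg/=; nra.
have zgE : z g = `|g| by apply/le_anti; rewrite zg/=; nra.
by rewrite (uniq y)// (uniq z)// (uniq x).
Qed.

End Bidual.

Section DistanceSup.
Context (R : realType) (V V' : normedModType R) (S : blin V V').
Context (W : set V') (W0 : W 0).

Let dists := [set dist_to W (S v) | v in unit_sphere V].

Lemma dist_to_image_le v : unit_sphere V v -> dist_to W (S v) <= `|S|.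
Proof.
move=> /= v1; apply: le_trans (dist_to_le_norm W0 _) _.
by apply: opnorm_ge; rewrite v1.
Qed.

Lemma dist_to_le_sup v : unit_sphere V v -> dist_to W (S v) <= sup dists.
Proof.
move=> v1; apply: sup_upper_bound; last by exists v.
split; first by exists (dist_to W (S v)), v.
by exists `|S| => _ [w w1 <-]; exact: dist_to_image_le.
Qed.

Lemma sup_dist_to_le v : unit_sphere V v -> sup dists <= `|S|.
Proof.
move=> v1; apply: ge_sup; first by exists (dist_to W (S v)), v.
by move=> _ [w w1 <-]; exact: dist_to_image_le.
Qed.

End DistanceSup.

Lemma dual_norm_le_sphere (R : realType) (V : normedModType R) (g : dual V) c :
  0 <= c -> (forall v, `|v| = 1 -> g v <= c) -> `|g| <= c.
Proof.
move=> c0 gc; apply: opnorm_le => v v1.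
have gv w : g w <= c * `|w|.
  have [->|w0] := eqVneq w 0; first by rewrite linear0 normr0 mulr0.
  rewrite mulrC -ler_pdivrMl ?normr_gt0//.
  have <- : g (`|w|^-1 *: w) = `|w|^-1 * g w by exact: linearZ_LR.
  by apply: gc; rewrite normfZV.
apply: (@le_trans _ _ (c * `|v|)); last by rewrite ler_piMr.
rewrite ler_norml gv andbT lerNl -[in leRHS]normrN.
have <- : g (- v) = - g v by exact: raddfN.
exact: gv.
Qed.

Lemma exists_unit_vector (R : realType) (X Y : normedModType R) (T : blin X Y) :
  T != 0 -> exists v, unit_sphere X v.
Proof.
move=> T0; apply: contrapT => noV; case/eqP: T0; apply/val_inj/funext => v /=.
have [->|v0] := eqVneq v 0; first exact: linear0.
by case: noV; exists (`|v|^-1 *: v); rewrite /unit_sphere /= normfZV.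
Qed.

Theorem theorem2p2 (R : realType) (X Y : completeNormedModType R)
    (Z : submodClosed Y) (T : blin X Y) :
  closed [set` Z] ->
  L1_predual (subspace_of Z) ->
  M_ideal Z ->
  compact_operator T ->
  multi_smooth_finite_order T ->
  bj_orthogonal_to T (operators_into X Z) ->
  let Zpp := annihilator (annihilator Z) in
  let Tss := adjoint (adjoint T) in
  let ii (x0 : dual (dual X)) := bj_orthogonal_to (Tss x0) [set` Zpp] in
  let iv (x0 : dual (dual X)) :=
    [/\ dist_to (operators_into (dual (dual X)) Zpp) Tss =
          sup [set dist_to [set` Zpp] (Tss x) |
                x in unit_sphere (dual (dual X))],
        sup [set dist_to [set` Zpp] (Tss x) |
              x in unit_sphere (dual (dual X))] =
          dist_to [set` Zpp] (Tss x0) &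
        dist_to [set` Zpp] (Tss x0) = dist_to (operators_into X Z) T] in
  [/\ dist_to (operators_into X Z) T =
        sup [set dist_to [set` Z] (T x) | x in unit_sphere X],
      exists x0, norm_attaining_set Tss x0 /\ ii x0,
      bj_orthogonal_to Tss (operators_into (dual (dual X)) Zpp),
      exists x0, norm_attaining_set Tss x0 /\ iv x0 &
      smooth_space (dual X) ->
        (exists x0, (norm_attaining_set Tss `&`
                     extreme_points (unit_ball (dual (dual X)))) x0 /\ ii x0) /\
        (exists x0, (norm_attaining_set Tss `&`
                     extreme_points (unit_ball (dual (dual X)))) x0 /\ iv x0)].

Proof.
move=> _ _ Zideal Tco Tms Tbj Zpp Tss ii iv.
have T0 : T != 0 by case: Tms.
have [x [f [Txf fZ]]] := norming_pair_annihilator Zideal Tco Tms Tbj.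
have Z0 : [set` Z] 0 by exact: rpred0.
have Zpp0 : [set` Zpp] 0 by exact: rpred0.
have XZ0 : operators_into X Z 0 by move=> v; exact: rpred0.
have XZpp0 : operators_into (dual (dual X)) Zpp 0 by move=> v; exact: rpred0.
have dT : dist_to (operators_into X Z) T = `|T| by exact: bj_dist_to.
have Tss_norm : `|Tss| = `|T| := norm_biadjoint Txf.
have x_ii : ii x by exact: norming_pair_bj T0 Txf _ fZ.
have Tss_bj : bj_orthogonal_to Tss (operators_into (dual (dual X)) Zpp).
  exact: bj_orthogonal_operators T0 Txf _ x_ii.
have [x_sphere Tx] := norming_pair_attains T0 Txf.
have dTx : dist_to [set` Zpp] (Tss x) = `|T|.
  by rewrite bj_dist_to// Tx.
have sup_dist : sup [set dist_to [set` Zpp] (Tss y) |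
    y in unit_sphere (dual (dual X))] = `|T|.
  apply/le_anti; rewrite -{1}Tss_norm (sup_dist_to_le Tss Zpp0 x_sphere)/=.
  by rewrite -{1}dTx dist_to_le_sup.
have x_iv : iv x.
  by split; rewrite ?sup_dist ?dTx ?dT// bj_dist_to.
have xM := norming_pair_attains T0 Txf.
split.
- rewrite dT; have [v v1] := exists_unit_vector T0.
  apply/le_anti; rewrite (sup_dist_to_le T Z0 v1) andbT.
  have [x1 f1 Tle] := Txf; apply: le_trans Tle _.
  apply: le_trans (dual_le (adjoint T f) x1) _; apply: dual_norm_le_sphere.
    apply: le_trans (dist_to_le_sup T Z0 v1).
    by apply: dist_to_ge.
  move=> w w1; apply: le_trans (dist_to_le_sup T Z0 w1).
  apply: (@dist_to_ge_functional _ _ _ Z0 f (T w)) => // z zZ.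
  by move/asboolP : fZ; exact.
- by exists x.
- by [].
- by exists x.
- move=> /(norming_pair_extreme T0 Txf) x_ext.
  by split; exists x.
Qed.
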